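(* The pair $(\beta,u)$, $\beta\in\mathbb{R}$, $u=(u_1,\dots,u_n)$, is a locked solution of the system (S) precisely in the following cases: (i) $\beta\in(\overline{\beta},\mu_1)\cup(\mu_n,\infty)$, and $u_j=\alpha_j(\beta)\,w$ for $j=1,\dots,n$, for some solution $w$ of the scalar problem $$-\Delta w+a(x)w=w^3,\qquad w\in E,\ w>0;$$ (ii) $\beta=\mu_1=\dots=\mu_n$, and $u_j=\alpha_j w$ for $j=1,\dots,n$, for some solution $w$ of the same scalar problem and some constants $\alpha_1,\dots,\alpha_n>0$ with $\alpha_1^2+\dots+\alpha_n^2=1/\beta$.
   Context: Setting. Let $n\ge 2$, $N\le 3$, let $\Omega\subset\mathbb{R}^N$ be a (possibly unbounded) domain invariant under a closed subgroup $G\subset O(N)$, and let $a\in L^\infty_{\rm loc}(\Omega)$ be $G$-invariant such that $-\Delta+a$ is a positive self-adjoint operator on $L^2(\Omega)$. Put $E:=\{u\in H^1_0(\Omega): u \text{ is } G\text{-invariant},\ \int_\Omega a u^2<\infty\}$ with norm $\|u\|_E^2=\int_\Omega|\nabla u|^2+\int_\Omega a u^2$, and assume that the embedding $E\hookrightarrow L^4(\Omega)$ is compact. Fix $0<\mu_1\le\mu_2\le\dots\le\mu_n$. For $\beta\in\mathbb{R}$ consider the system (S) $\quad -\Delta u_j+a(x)u_j=\mu_j u_j^3+\beta\sum_{k\ne j}u_k^2u_j,\quad u_j\in E,\ u_j>0,\quad j=1,\dots,n.$ Equations are understood in the weak sense. A solution of (S) is a pair $(\beta,u)$ with $u=(u_1,\dots,u_n)$.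 It is called locked if $u_i/u_j$ is constant for all $i,j$. Define $g(\beta):=1+\beta\sum_{k=1}^n\frac{1}{\mu_k-\beta}$. On $(-\infty,\mu_1)$ the function $g$ is strictly increasing with $g(0)=1$ and $g(\beta)\to1-n<0$ as $\beta\to-\infty$; $\overline{\beta}<0$ denotes its unique zero in $(-\infty,\mu_1)$. Moreover $g<0$ on $(\mu_n,\infty)$. For $\beta\in(\overline{\beta},\mu_1)\cup(\mu_n,\infty)$ set $\alpha_j(\beta):=\big((\mu_j-\beta)g(\beta)\big)^{-1/2}$, $j=1,\dots,n$. *)

(* Defs.v *)
From HB Require Import structures.
From mathcomp Require Import all_boot all_order all_algebra.
From mathcomp Require Import all_classical all_reals all_analysis.

Set Implicit Arguments.
Unset Strict Implicit.
Unset Printing Implicit Defensive.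

Import Order.TTheory GRing.Theory Num.Theory.
Import numFieldNormedType.Exports.

Local Open Scope classical_set_scope.
Local Open Scope ring_scope.

(* Lebesgue measure on R^N, with R^N represented as 'rV[R]_N.  As for the
   library's n.-tuple T, the sigma-algebra is generated by the coordinates; it
   is the Borel sigma-algebra of the topology of 'rV[R]_N. *)

Definition coord (R : realType) (N : nat) (i : 'I_N) (x : 'rV[R]_N) : R :=
  x ord0 i.

Definition rowvec_display : measure_display. Proof. exact. Qed.

Section rowvec_measurable.
Variables (R : realType) (N : nat).

Let rv_set0 : g_sigma_preimage (@coord R N) set0.
Proof. exact: sigma_algebra0. Qed.

Let rv_setC A :
  g_sigma_preimage (@coord R N) A -> g_sigma_preimage (@coord R N) (~` A).
Proof. exact: sigma_algebraC. Qed.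

Let rv_bigcup (F : (set 'rV[R]_N)^nat) :
  (forall i, g_sigma_preimage (@coord R N) (F i)) ->
  g_sigma_preimage (@coord R N) (\bigcup_i (F i)).
Proof. exact: sigma_algebra_bigcup. Qed.

HB.instance Definition _ := @isMeasurable.Build rowvec_display
  'rV[R]_N (g_sigma_preimage (@coord R N)) rv_set0 rv_setC rv_bigcup.

End rowvec_measurable.

Lemma measurable_coord (R : realType) (N : nat) (i : 'I_N) :
  measurable_fun [set: 'rV[R]_N] (coord i).
Proof.
move=> _ Y mY; rewrite setTI; apply: sub_sigma_algebra => /=.
rewrite -bigcup_seq/=; exists i => /=; first by rewrite mem_index_enum.
by exists Y => //; rewrite setTI.
Qed.

Lemma measurable_fun_coordP (d : measure_display) (T : measurableType d)
    (R : realType) (N : nat) (f : T -> 'rV[R]_N) :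
  (forall i, measurable_fun [set: T] (coord i \o f)) ->
  measurable_fun [set: T] f.
Proof.
move=> mf; suff H : g_sigma_preimage (fun i : 'I_N => coord i \o f)
    `<=` measurable.
  by move=> _ A mA; apply: H; rewrite g_sigma_preimage_comp; exists A.
apply: smallest_sub; first exact: sigma_algebra_measurable.
case: N => [|n] in f mf *; first by rewrite big_ord0.
rewrite -bigcup_mkord_ord; apply: bigcup_sub => i Ii.
by move=> A [B mB <-]; exact: mf.
Qed.

Definition row_rcons (R : realType) (N : nat) (p : 'rV[R]_N * R) : 'rV[R]_N.+1 :=
  \row_i (if unlift ord_max i is Some j then coord j p.1 else p.2).

Lemma measurable_row_rcons (R : realType) (N : nat) :
  measurable_fun [set: 'rV[R]_N * R] (@row_rcons R N).
Proof.
apply: measurable_fun_coordP => i.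
rewrite (_ : coord i \o _ =
  fun p => if unlift ord_max i is Some j then coord j p.1 else p.2); last first.
  by apply/funext => p; rewrite /coord /= mxE.
case: (unlift ord_max i) => [j|]; last exact: measurable_snd.
exact: (measurableT_comp (measurable_coord j) measurable_fst).
Qed.

Section leb_succ.
Variables (R : realType) (N : nat) (m : {measure set 'rV[R]_N -> \bar R}).

Definition leb_succ : set 'rV[R]_N.+1 -> \bar R :=
  pushforward (m \x @lebesgue_measure R)%E (@row_rcons R N).

Let leb_succ0 : leb_succ set0 = 0%E.
Proof. by rewrite /leb_succ /pushforward preimage_set0 measure0. Qed.

Let leb_succ_ge0 A : (0 <= leb_succ A)%E.
Proof. by apply: integral_ge0 => x _; exact: measure_ge0. Qed.

Let leb_succ_sigma_additive : semi_sigma_additive leb_succ.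
Proof.
exact: (@measure_semi_sigma_additive _ _ _
  (measure_function_pushforward__canonical__measure_function_Measure
     (product_measure1 m (@lebesgue_measure R)) (@measurable_row_rcons R N))).
Qed.

HB.instance Definition _ := isMeasure.Build _ _ _
  leb_succ leb_succ0 leb_succ_ge0 leb_succ_sigma_additive.

End leb_succ.

(* R^0 is a point of mass 1, and R^(N+1) carries the product measure of
   R^N x R. *)
Fixpoint leb (R : realType) (N : nat) : {measure set 'rV[R]_N -> \bar R} :=
  match N return {measure set 'rV[R]_N -> \bar R} with
  | 0 => \d_(0 : 'rV[R]_0)
  | M.+1 => leb_succ (leb R M)
  end.

Lemma leb_box (R : realType) (N : nat) (A : 'I_N -> set R) :
  (forall i, measurable (A i)) ->
  leb R N [set x | forall i, A i (coord i x)] =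
  (\prod_(i < N) lebesgue_measure (A i))%E.
Proof.
elim: N A => [|N IH] A mA.
  rewrite big_ord0 /= /dirac indicE.
  by rewrite mem_set //= => -[].
rewrite big_ord_recr /= /leb_succ /pushforward.
rewrite [X in product_measure1 _ _ X](_ : _ =
  [set x | forall i : 'I_N, A (widen_ord (leqnSn N) i) (coord i x)]
    `*` A ord_max); last first.
  have wE (i : 'I_N) : widen_ord (leqnSn N) i = lift ord_max i.
    by apply/val_inj; rewrite /= /bump leqNgt ltn_ord.
  apply/seteqP; split=> [[x y]|[x y]] /= H.
    split=> [i|].
      by have := H (lift ord_max i); rewrite /coord mxE liftK wE.
    by have := H ord_max; rewrite /coord mxE unlift_none.
  move=> i; rewrite /coord mxE; case: unliftP => [j ->|->].
    by rewrite -wE; exact: H.1.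
  exact: H.2.
rewrite product_measure1E; [by congr (_ * _)%E; exact: IH| |exact: mA].
rewrite [X in measurable X](_ : _ =
  \bigcap_(i in [set: 'I_N]) (coord i @^-1` A (widen_ord (leqnSn N) i))).
  apply: fin_bigcap_measurable => [//|i _]; rewrite -[X in measurable X]setTI.
  exact: measurable_coord.
by apply/seteqP; split => [x H i _|x H i]; [exact: H|exact: (H i I)].
Qed.

(* Elements of the function spaces on Omega are represented by Borel functions
   'rV[R]_N -> R, of which only the values on Omega matter, up to almost
   everywhere equality. *)
Section spaces.
Variables (R : realType) (N : nat).

Implicit Types (Omega : set 'rV[R]_N) (f h u w phi : 'rV[R]_N -> R).
Implicit Types (gu gw gphi : 'I_N -> 'rV[R]_N -> R).

Local Notation mu := (leb R N).

Definition is_domain Omega := [/\ open Omega, connected Omega & Omega !=set0].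

(* The matrix A acts on the row vector x by the usual A x, i.e. x *m A^T. *)
Definition lin_act (A : 'M[R]_N) (x : 'rV[R]_N) : 'rV[R]_N := x *m A^T.

Definition closed_orthogonal_subgroup (G : set 'M[R]_N) :=
  [/\ (forall A, G A -> A *m A^T = 1%:M), G 1%:M,
      (forall A B, G A -> G B -> G (A *m B)),
      (forall A, G A -> G (invmx A)) & closed G].

Definition invariant_set (G : set 'M[R]_N) Omega :=
  forall A x, G A -> Omega x -> Omega (lin_act A x).

Definition invariant_fun (G : set 'M[R]_N) Omega u :=
  forall A, G A -> {ae mu, forall x, Omega x -> u (lin_act A x) = u x}.

Definition Lp Omega (p : nat) u :=
  measurable_fun Omega u /\
  mu.-integrable Omega (fun x => (`|u x| ^+ p)%:E).

Definition Linfty_loc Omega u :=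
  measurable_fun Omega u /\
  forall K, compact K -> K `<=` Omega ->
    exists C : R, {ae mu, forall x, K x -> `|u x| <= C}.

Definition dist_pow Omega (p : nat) f h : \bar R :=
  (\int[mu]_(x in Omega) (`|f x - h x| ^+ p)%:E)%E.

Definition pderiv (i : 'I_N) f : 'rV[R]_N -> R :=
  fun x => 'D_(delta_mx ord0 i) f x.

Definition smooth f := forall s : seq 'I_N,
  let fs := foldr pderiv f s in
  continuous fs /\ forall i x, derivable fs x (delta_mx ord0 i).

Definition test_fun Omega phi :=
  let supp := closure [set x | phi x != 0] in
  [/\ smooth phi, compact supp & supp `<=` Omega].

Definition weak_gradient Omega u gu := forall i phi, test_fun Omega phi ->
  \int[mu]_(x in Omega) (u x * pderiv i phi x) =
  - \int[mu]_(x in Omega) (gu i x * phi x).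

Definition H1 Omega u gu :=
  [/\ Lp Omega 2 u, (forall i, Lp Omega 2 (gu i)) & weak_gradient Omega u gu].

(* u belongs to H^1_0(Omega), the closure of C_c^oo(Omega) in H^1(Omega), and
   gu is its weak gradient. *)
Definition H10 Omega u gu :=
  H1 Omega u gu /\
  exists phi : nat -> 'rV[R]_N -> R,
    [/\ (forall k, test_fun Omega (phi k)),
        dist_pow Omega 2 (phi k) u @[k --> \oo] --> 0%E &
        forall i, dist_pow Omega 2 (pderiv i (phi k)) (gu i)
          @[k --> \oo] --> 0%E].

Section potential.
Variables (Omega : set 'rV[R]_N) (a : 'rV[R]_N -> R).

(* The form domain of -Delta + a. *)
Definition energy_space u gu :=
  H10 Omega u gu /\ mu.-integrable Omega (fun x => (a x * u x ^+ 2)%:E).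

Definition energy_form u gu w gw : R :=
  \int[mu]_(x in Omega) (\sum_(i < N) gu i x * gw i x) +
  \int[mu]_(x in Omega) (a x * u x * w x).

(* u is a weak solution of - Delta u + a u = f.  The test functions range over
   the whole form domain, which contains C_c^oo(Omega) and the space E below. *)
Definition weak_solution u f := exists2 gu, energy_space u gu &
  forall phi gphi, energy_space phi gphi ->
    energy_form u gu phi gphi = \int[mu]_(x in Omega) (f x * phi x).

(* The graph of -Delta + a in L^2(Omega), realized through its form. *)
Definition schrodinger_op u f := Lp Omega 2 f /\ weak_solution u f.

Definition L2_inner f h : R := \int[mu]_(x in Omega) (f x * h x).

(* For the graph T of an operator: its domain is dense, it coincides with its
   adjoint, and (Tu, u) > 0 unless u = 0. *)
Definition positive_self_adjoint
    (T : ('rV[R]_N -> R) -> ('rV[R]_N -> R) -> Prop) :=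
  [/\ (forall v (e : R), Lp Omega 2 v -> 0 < e ->
         exists u f, T u f /\ (dist_pow Omega 2 u v < e%:E)%E),
      (forall v h, Lp Omega 2 v -> Lp Omega 2 h ->
         (forall u f, T u f -> L2_inner f v = L2_inner u h) <-> T v h) &
      forall u f, T u f -> ~ {ae mu, forall x, Omega x -> u x = 0} ->
        0 < L2_inner f u].

Variable G : set 'M[R]_N.

Definition E_grad u gu := energy_space u gu /\ invariant_fun G Omega u.

Definition in_E u := exists gu, E_grad u gu.

Definition E_norm2 u gu : R := energy_form u gu u gu.

(* ||.||_E is positive definite. *)
Definition E_norm_definite := forall u gu, E_grad u gu ->
  ~ {ae mu, forall x, Omega x -> u x = 0} -> 0 < E_norm2 u gu.

Definition E_compact_in_L4 :=
  (forall u, in_E u -> Lp Omega 4 u) /\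
  forall (u : nat -> 'rV[R]_N -> R) (gu : nat -> 'I_N -> 'rV[R]_N -> R) (C : R),
    (forall k, E_grad (u k) (gu k)) -> (forall k, E_norm2 (u k) (gu k) <= C) ->
    exists (s : nat -> nat) (v : 'rV[R]_N -> R),
      [/\ {homo s : k l / (k < l)%N}, Lp Omega 4 v &
          dist_pow Omega 4 (u (s k)) v @[k --> \oo] --> 0%E].

Definition pos_ae u := {ae mu, forall x, Omega x -> 0 < u x}.

Definition scalar_solution w :=
  [/\ in_E w, pos_ae w & weak_solution w (fun x => w x ^+ 3)].

Definition system_solution (n : nat) (m : 'I_n -> R) (beta : R)
    (u : 'I_n -> 'rV[R]_N -> R) := forall j,
  [/\ in_E (u j), pos_ae (u j) &
      weak_solution (u j) (fun x => m j * u j x ^+ 3 +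
        beta * \sum_(k < n | k != j) u k x ^+ 2 * u j x)].

Definition locked_tuple (n : nat) (u : 'I_n -> 'rV[R]_N -> R) := forall i j,
  exists c : R, {ae mu, forall x, Omega x -> u i x / u j x = c}.

End potential.
End spaces.

Section coupling.
Variables (R : realType) (n : nat) (hn : (2 <= n)%N) (m : 'I_n -> R).

Let last_lt : (n.-1 < n)%N. Proof. by case: n hn. Qed.

Definition mu_first : R := m (Ordinal (ltnW hn)).
Definition mu_last : R := m (Ordinal last_lt).

Definition gfun (beta : R) : R := 1 + beta * \sum_(k < n) (m k - beta)^-1.

(* the unique zero of g in (-oo, mu_1) *)
Definition betabar : R := get [set b | b < mu_first /\ gfun b = 0].

Definition alpha_coef (j : 'I_n) (beta : R) : R :=
  (Num.sqrt ((m j - beta) * gfun beta))^-1.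

End coupling.

(* Main.v *)
(* If u_j = c_j u_1 a.e., the j-th equation reads -Delta u_j + a u_j = K_j c_j u_1^3
   with K_j = (m_j - beta) c_j^2 + beta * sum_k c_k^2.  Testing the j-th equation
   with u_1 and the first one with u_j, the symmetry of the energy form gives
   K_j = K_1, and positivity of the norm of E gives K_1 > 0; then
   w = sqrt(K_1) u_1 solves the scalar problem.  After normalization K_j = 1 for
   all j, an algebraic system in the c_j that is solved explicitly.
   Conversely, functions that are a.e. multiples of w solve the system;
   G-invariance passes to an a.e. equal function because invertible
   linear maps pull Lebesgue null sets back to null sets. *)

Require Import Defs.
From HB Require Import structures.
From mathcomp Require Import all_boot all_order all_algebra.
From mathcomp Require Import all_classical all_reals all_analysis.
From mathcomp Require Import ring lra measurable_realfun.

Set Implicit Arguments.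
Unset Strict Implicit.
Unset Printing Implicit Defensive.

Import Order.TTheory GRing.Theory Num.Theory.
Import numFieldNormedType.Exports.

Local Open Scope classical_set_scope.
Local Open Scope ring_scope.

(* [coord] alone denotes the coordinates in a basis, from vector.v. *)
Local Notation coord := Defs.coord.

(** * Lebesgue null sets of R^N *)

(** The product measure of [A] is the integral of the nonnegative function
    [x |-> m2 (xsection A x)], which vanishes exactly when that function is zero a.e. As [m1] is any
    measure, this applies at each step of the recursion defining [leb]. *)
Lemma null_ae_xsection (d1 d2 : measure_display) (T1 : measurableType d1)
    (T2 : measurableType d2) (R : realType) (m1 : {measure set T1 -> \bar R})
    (m2 : {sigma_finite_measure set T2 -> \bar R}) (A : set (T1 * T2)) :
  measurable A ->
  (m1 \x m2)%E A = 0%E <-> {ae m1, forall x, m2 (xsection A x) = 0%E}.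
Proof.
move=> mA; have mf := measurable_fun_xsection m2 mA.
rewrite /product_measure1.
have -> : (\int[m1]_x (m2 \o xsection A) x = \int[m1]_x `|(m2 \o xsection A) x|)%E.
  by apply: eq_integral => x _; rewrite gee0_abs// measure_ge0.
split=> [/(ae_eq_integral_abs _ measurableT mf)|H].
  by apply: filterS => x /= /(_ I).
by apply/(ae_eq_integral_abs _ measurableT mf); apply: filterS H => x /= + _.
Qed.

(** By Tonelli both iterated integrals of the indicator of [A] agree. The one over x-sections is
    zero, so the integrand of the other vanishes a.e. *)
Lemma ae_null_ysection (d1 d2 : measure_display) (T1 : measurableType d1)
    (T2 : measurableType d2) (R : realType)
    (m1 : {sigma_finite_measure set T1 -> \bar R})
    (m2 : {sigma_finite_measure set T2 -> \bar R}) (A : set (T1 * T2)) :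
  measurable A -> (forall x, m2 (xsection A x) = 0%E) ->
  {ae m2, forall y, m1 (ysection A y) = 0%E}.
Proof.
move=> mA A0; have mf := measurable_fun_ysection m1 mA.
suff : (\int[m2]_y `|(m1 \o ysection A) y| = 0)%E.
  move=> /(ae_eq_integral_abs _ measurableT mf).
  by apply: filterS => x /= /(_ I).
have := indic_fubini_tonelli m1 m2 mA.
rewrite indic_fubini_tonelli_FE// indic_fubini_tonelli_GE//.
rewrite integral0_eq//= => ->.
by apply: eq_integral => x _; rewrite gee0_abs// measure_ge0.
Qed.

(** The pushforward under translation agrees with Lebesgue measure on half-open intervals, and this
    determines the measure. *)
Lemma lebesgue_measure_shift (R : realType) (t : R) (A : set R) :
  measurable A -> lebesgue_measure ((fun x => x + t) @^-1` A) = lebesgue_measure A.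
Proof.
move=> mA.
have mt : measurable_fun [set: measurableTypeR R]
    ((fun x => x + t) : _ -> measurableTypeR R).
  by apply: (@measurable_funD _ _ _ _ id (cst t)).
pose nu : {measure set measurableTypeR R -> \bar R} := measure_function_pushforward__canonical__measure_function_Measure
  (@lebesgue_measure R) mt.
apply/esym/(@lebesgue_measure_unique R nu) => // X.
move=> /ocitvP[->|[[p q] /= pq ->]]; first by rewrite !measure0.
rewrite /pushforward (_ : _ @^-1` _ = `]p - t, q - t]%classic).
  by rewrite !lebesgue_measure_itv/= !lte_fin ltrD2r pq; congr EFin; ring.
by apply/seteqP; split=> x /=; rewrite !in_itv/= ltrBlDr lerBrDr.
Qed.

(** * Open sets and continuous functions for the coordinate sigma-algebra *)

Section rowvec_borel.
Variables (R : realType) (N : nat).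

Lemma measurable_box (A : 'I_N -> set R) : (forall i, measurable (A i)) ->
  measurable [set x : 'rV[R]_N | forall i, A i (coord i x)].
Proof.
move=> mA; rewrite [X in measurable X](_ : _ =
    \bigcap_(i in [set: 'I_N]) (coord i @^-1` A i)).
  apply: fin_bigcap_measurable => [//|i _]; rewrite -[X in measurable X]setTI.
  exact: measurable_coord.
by apply/seteqP; split => [x H i _|x H i]; [exact: H|exact: (H i I)].
Qed.

Lemma rV_ballE (x : 'rV[R]_N) (e : R) :
  0 < e ->
  ball x e = [set y | forall i, `]coord i x - e, coord i x + e[%classic (coord i y)].
Proof.
move=> e0.
apply/seteqP; split=> y /= H.
  move=> i; have := H.2 ord0 i.
  by rewrite /ball /= ltr_distlC in_itv.
split=> // i j; have := H j; rewrite (ord1 i) in_itv /= /ball/=.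
by rewrite ltr_distlC.
Qed.

(** The sigma-algebra is generated by the coordinates, so [U] is written as a countable union of
    boxes with rational centre and radius. A box not contained in [U] is replaced by the empty
    set. *)
Lemma open_measurable_rV (U : set 'rV[R]_N) : open U -> measurable U.
Proof.
move=> oU.
pose J (p : 'rV[rat]_N * rat) i : set R :=
  `]ratr (p.1 ord0 i) - ratr p.2, ratr (p.1 ord0 i) + ratr p.2[%classic.
pose B p : set 'rV[R]_N := [set y | forall i, J p i (coord i y)].
rewrite (_ : U = \bigcup_p (if `[< B p `<=` U >] then B p else set0)).
  apply: countable_bigcupT_measurable => [|p]; first exact: countableP.
  case: ifP => _; last exact: measurable0.
  by apply: (measurable_box (A := J p)) => i; exact: measurable_itv.
apply/seteqP; split=> [x Ux|x [p _]]; last by case: asboolP => // + Bx; exact.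
have /nbhs_ballP[e /= e0 xeU] : nbhs x U by exact: open_nbhs_nbhs.
(* With radius [r < e / 2] and a centre within [r] of [x], the rational box contains [x] and stays
   within [2 * r < e] of it. *)
have e2 : 0 < e / 2 by rewrite divr_gt0.
have [r] := rat_in_itvoo e2; rewrite in_itv/= => /andP[r0 re].
have Hq i : exists q : rat, ratr q \in `](x ord0 i - ratr r), (x ord0 i + ratr r)[.
  by apply: rat_in_itvoo; rewrite ltrD2l gtrN.
have [q qP] := choice Hq.
exists (\row_i q i, r) => //.
case: asboolP => [_ i|]; rewrite /J /=.
  have := qP i; rewrite mxE /coord !in_itv/= => /andP[? ?].
  by apply/andP; split; lra.
case=> y By; apply: xeU; rewrite rV_ballE// => i /=.
have := By i; have := qP i.
rewrite /J /= mxE /coord !in_itv/= => /andP[? ?] /andP[? ?].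
by apply/andP; split; lra.
Qed.

Lemma continuous_measurable_rV (f : 'rV[R]_N -> R) :
  continuous f -> measurable_fun [set: 'rV[R]_N] f.
Proof.
move=> cf; apply: (measurability _ (RGenOpens.measurableE R)) => //.
move=> _ [_ [a [b ->] <-]]; rewrite setTI; apply: open_measurable_rV.
apply: open_comp => [x _|]; first exact: cf.
exact: interval_open.
Qed.

End rowvec_borel.

(** * Sigma-finiteness, and null sets under translations and invertible linear maps *)

Section leb_null_sets.
Variable R : realType.

(** The cubes [[-k, k]^N] exhaust the space, and each has finite measure by [leb_box]. *)
Lemma leb_sigma_finite (N : nat) : sigma_finite [set: 'rV[R]_N] (leb R N).
Proof.
pose J (k : nat) (i : 'I_N) : set R := `[- k%:R, k%:R]%classic.
exists (fun k => [set x : 'rV[R]_N | forall i, J k i (coord i x)]).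
  apply/esym/seteqP; split=> // x _.
  have s0 : 0 <= \sum_i `|coord i x| by exact: sumr_ge0.
  exists (Num.bound (\sum_i `|coord i x|)) => //= i.
  rewrite /J /= in_itv/= -ler_norml (le_trans _ (ltW (archi_boundP s0)))//.
  by rewrite (bigD1 i)//= lerDl sumr_ge0.
move=> k; split; first by apply: (measurable_box (A := J k)) => i; exact: measurable_itv.
rewrite (leb_box (A := J k)) => [|i]; last exact: measurable_itv.
suff /andP[] : ((0 <= \prod_(i < N) lebesgue_measure (J k i)) &&
  (\prod_(i < N) lebesgue_measure (J k i) < +oo))%E by [].
elim/big_ind: _ => [|x y /andP[x0 xoo] /andP[y0 yoo]|i _].
- by rewrite lee01 ltry.
- by rewrite mule_ge0//= lte_mul_pinfty// ge0_fin_numE.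
- rewrite measure_ge0 /= /J lebesgue_measure_itv/=; case: ifP => // _.
  by rewrite -EFinB ltry.
Qed.

(* A named set function, as instances cannot be attached to the fixpoint [leb]
   itself: Fubini's theorem needs a sigma-finite structure. *)
Definition leb_function (N : nat) : set 'rV[R]_N -> \bar R := leb R N.

HB.instance Definition _ (N : nat) :=
  Measure.copy (leb_function (N:=N)) (leb R N).

HB.instance Definition _ (N : nat) :=
  Measure_isSigmaFinite.Build _ _ _ (leb_function (N:=N)) (leb_sigma_finite N).

(** A nonempty open set contains a ball of the sup norm, which is a box with sides of positive
    length. *)
Lemma leb_open_gt0 (N : nat) (U : set 'rV[R]_N) :
  open U -> U !=set0 -> (0 < leb R N U)%E.
Proof.
move=> oU [x Ux].
have /nbhs_ballP[e /= e0 xeU] : nbhs x U by exact: open_nbhs_nbhs.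
pose J i : set R := `]coord i x - e, coord i x + e[%classic.
have mJ i : measurable (J i) by exact: measurable_itv.
have bE : ball x e = [set y | forall i, J i (coord i y)] by exact: rV_ballE.
apply: (@lt_le_trans _ _ (leb R N (ball x e))); last first.
  apply: le_measure => //; rewrite inE.
    by rewrite bE; exact: measurable_box.
  exact: open_measurable_rV.
rewrite bE leb_box//; elim/big_ind: _ => [||i _]; first exact: lte01.
  by move=> y z y0 z0; exact: mule_gt0.
rewrite /J lebesgue_measure_itv/= lte_fin.
have xe : coord i x - e < coord i x + e by lra.
by rewrite xe -EFinB lte_fin subr_gt0.
Qed.

Lemma measurable_shift_rV (N : nat) (t : 'rV[R]_N) :
  measurable_fun [set: 'rV[R]_N] (fun x => x + t).
Proof.
apply: measurable_fun_coordP => i.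
rewrite (_ : _ \o _ = fun x => coord i x + coord i t); last first.
  by apply/funext => x; rewrite /coord /= mxE.
exact: (@measurable_funD _ _ _ _ (coord i) (cst (coord i t)) (@measurable_coord R N i)).
Qed.

(** Induction on the dimension: a section of a translate is a one-dimensional translate of a section
    of [E], taken at a translated base point. The base points with a non-null section form a null
    set by the induction hypothesis. *)
Lemma leb_null_shift (N : nat) (t : 'rV[R]_N) (E : set 'rV[R]_N) :
  measurable E -> leb R N E = 0%E -> leb R N ((fun x => x + t) @^-1` E) = 0%E.
Proof.
elim: N t E => [|N IH] t E mE E0.
  rewrite (_ : _ @^-1` E = E)//.
  by apply/seteqP; split=> x /=; rewrite (_ : x + t = x)// !thinmx0.
have mS : measurable ((fun x => x + t) @^-1` E).
  by rewrite -[X in measurable X]setTI; exact: measurable_shift_rV.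
have mP (F : set 'rV[R]_N.+1) : measurable F -> measurable (@row_rcons R N @^-1` F).
  by move=> mF; rewrite -[X in measurable X]setTI; exact: measurable_row_rcons.
pose t' : 'rV[R]_N := \row_i t ord0 (lift ord_max i).
have shiftE x s : row_rcons (x, s) + t = row_rcons (x + t', s + t ord0 ord_max).
  apply/rowP => i; rewrite !mxE; case: unliftP => [j ->|->] //=.
  by rewrite /coord !mxE.
have [Z [mZ Z0 ZP]] := (null_ae_xsection (leb R N) (@lebesgue_measure R) (mP _ mE)).1 E0.
apply: (null_ae_xsection (leb R N) (@lebesgue_measure R) (mP _ mS)).2.
exists ((fun x => x + t') @^-1` Z); split.
- by rewrite -[X in measurable X]setTI; exact: measurable_shift_rV.
- exact: IH.
move=> x /= Nx; apply: ZP => /= x0; apply: Nx.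
rewrite (_ : xsection _ x = (fun s => s + t ord0 ord_max) @^-1`
    xsection (@row_rcons R N @^-1` E) (x + t')).
  rewrite lebesgue_measure_shift//.
  exact: (measurable_xsection (x + t') (mP _ mE)).
by apply/seteqP; split=> s /=; rewrite /xsection/= !inE /= shiftE.
Qed.

Lemma measurable_mulmx (N : nat) (M : 'M[R]_N) :
  measurable_fun [set: 'rV[R]_N] (fun x => x *m M).
Proof.
apply: measurable_fun_coordP => i.
rewrite (_ : _ \o _ = fun x => \sum_j coord j x * M j i); last first.
  by apply/funext => x; rewrite /coord /= mxE.
apply: measurable_sum => j.
exact: (@measurable_funM _ _ _ _ (coord j) (cst (M j i)) (@measurable_coord R N j)).
Qed.

(* Fubini on {(x, y) | x M + y in E}: the x-sections are translates of E, and
   the y-sections are translates of the preimage of E under M. *)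
Lemma leb_null_mulmx (N : nat) (M : 'M[R]_N) (E : set 'rV[R]_N) :
  M \in unitmx -> measurable E -> leb R N E = 0%E ->
  leb R N ((fun x => x *m M) @^-1` E) = 0%E.
Proof.
move=> uM mE E0.
pose h (p : 'rV[R]_N * 'rV[R]_N) := p.1 *m M + p.2.
have mh : measurable_fun setT h.
  apply: measurable_fun_coordP => i.
  rewrite (_ : _ \o _ = fun p => coord i (p.1 *m M) + coord i p.2); last first.
    by apply/funext => x; rewrite /coord /= mxE.
  apply: measurable_funD.
    apply: (measurableT_comp (measurable_coord i)).
    exact: (measurableT_comp (@measurable_mulmx N M) measurable_fst).
  exact: (measurableT_comp (measurable_coord i) measurable_snd).
have mB : measurable (h @^-1` E) by rewrite -[X in measurable X]setTI; exact: mh.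
have [|Z [mZ Z0 ZP]] :=
  ae_null_ysection (leb_function (N:=N)) (m2 := leb_function (N:=N)) mB.
  move=> x; rewrite (_ : xsection _ x = (fun y => y + x *m M) @^-1` E).
    exact: leb_null_shift.
  by apply/seteqP; split => y /=; rewrite /xsection /= inE /h /= addrC.
(* The whole space is not null, so some [y] lies outside the exceptional set [Z]. *)
have [y NZy] : exists y, ~ Z y.
  apply/existsNP => Zall.
  have : (0 < leb R N setT)%E by apply: leb_open_gt0; [exact: openT|exists 0].
  rewrite (_ : setT = Z); last by apply/seteqP; split.
  by have -> : leb R N Z = 0%E := Z0; rewrite ltxx.
have {NZy} y0 : leb R N (ysection (h @^-1` E) y) = 0%E.
  by apply: contrapT => ny; apply: NZy; exact: ZP.
(* Since [(x - y M^-1) M + y = x M], translating the section at [y] by [- y M^-1] gives exactly the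
   preimage of [E] under [M]. *)
have := leb_null_shift (- (y *m invmx M)) (measurable_ysection y mB) y0.
congr (leb R N _ = _); apply/seteqP; split => x /=.
  by rewrite /ysection /= inE /h /= mulmxDl mulNmx mulmxKV// subrK.
by rewrite /ysection /= inE /h /= mulmxDl mulNmx mulmxKV// subrK.
Qed.

End leb_null_sets.

(** * Multiples of functions in the energy space *)

Section integral_scaling.
Context (d : measure_display) (T : measurableType d) (R : realType).
Variables (mu : {measure set T -> \bar R}) (D : set T) (mD : measurable D).
Variables (c : R) (c0 : 0 < c).

(* For non-integrable f too: both sides are then simultaneously +oo, -oo or the
   conventional value of oo - oo, since c > 0. *)
Lemma gt0_integralZl (f : T -> \bar R) : measurable_fun D f ->
  (\int[mu]_(x in D) (c%:E * f x) = c%:E * \int[mu]_(x in D) f x)%E.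
Proof.
move=> mf; rewrite integralE [in RHS]integralE.
rewrite ge0_funeposM ?ge0_funenegM ?ltW//.
rewrite ge0_integralZl//; [|exact: measurable_funepos|by rewrite lee_fin ltW].
rewrite ge0_integralZl//; [|exact: measurable_funeneg|by rewrite lee_fin ltW].
have := integral_ge0 mu (D := D) (f := f^\+%E) (fun x _ => funepos_ge0 f x).
have := integral_ge0 mu (D := D) (f := f^\-%E) (fun x _ => funeneg_ge0 f x).
(* Both parts have nonnegative integrals, so neither value is [-oo] and four cases remain. *)
move: (integral _ _ _) (integral _ _ _) => [y| |] [x| |]//= _ _.
- by congr EFin; ring.
all: by rewrite ?gt0_muley ?lte_fin//= ?gt0_muley ?gt0_muleNy ?lte_fin.
Qed.

Variables (f g : T -> R) (mf : measurable_fun D f) (mg : measurable_fun D g).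
Hypothesis gE : {ae mu, forall x, D x -> g x = c * f x}.

Lemma ae_integralZl :
  (\int[mu]_(x in D) (g x)%:E = c%:E * \int[mu]_(x in D) (f x)%:E)%E.
Proof.
rewrite -gt0_integralZl; last exact/measurable_EFinP.
apply: ae_eq_integral => //; first exact/measurable_EFinP.
  by apply: emeasurable_funM => //; exact/measurable_EFinP.
by apply: filterS gE => x /= gx /gx ->; rewrite EFinM.
Qed.

Lemma ae_RintegralZl :
  \int[mu]_(x in D) g x = c * \int[mu]_(x in D) f x.
Proof.
rewrite /Rintegral ae_integralZl.
case: (integral _ _ _) => [x| |]//=; rewrite ?gt0_muley ?gt0_muleNy ?lte_fin//=.
(* An infinite integral has real value 0 by convention, so both sides are 0 here. *)
all: by rewrite mulr0.
Qed.

Lemma ae_integrableZl :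
  mu.-integrable D (EFin \o f) -> mu.-integrable D (EFin \o g).
Proof.
move=> /(integrableZl mD c) /integrableP[_ cf].
apply/integrableP; split; first exact/measurable_EFinP.
apply: le_lt_trans cf; rewrite le_eqVlt; apply/orP; left; apply/eqP.
apply: ae_eq_integral => //.
- by apply: measurableT_comp => //; exact/measurable_EFinP.
- apply: measurableT_comp => //.
  by apply: emeasurable_funM => //; exact/measurable_EFinP.
- by apply: filterS gE => x /= gx /gx ->.
Qed.

End integral_scaling.

Lemma eq_ae_Rintegral (d : measure_display) (T : measurableType d) (R : realType)
    (mu : {measure set T -> \bar R}) (D : set T) (f g : T -> R) :
  measurable D -> measurable_fun D f -> measurable_fun D g ->
  {ae mu, forall x, D x -> f x = g x} ->
  \int[mu]_(x in D) f x = \int[mu]_(x in D) g x.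
Proof.
move=> mD mf mg fg; rewrite (ae_RintegralZl mD ltr01 mg mf) ?mul1r//.
by apply: filterS fg => x /= + Dx => ->//; rewrite mul1r.
Qed.

(** * Multiples and measurability of test functions *)

Section test_function_scaling.
Variables (R : realType) (N : nat) (Omega : set 'rV[R]_N).
Variables (c : R) (phi : 'rV[R]_N -> R).

Lemma foldr_pderivZ (s : seq 'I_N) : smooth phi ->
  foldr (@pderiv R N) (fun x => c * phi x) s =
  (fun x => c * foldr (@pderiv R N) phi s x).
Proof.
move=> sphi; elim: s => //= i s ->; apply/funext => x.
rewrite /pderiv -[RHS]/(c *: _) -deriveZ//.
by have [_] := sphi s; exact.
Qed.

Lemma test_funZ : 0 < c -> test_fun Omega phi -> test_fun Omega (fun x => c * phi x).
Proof.
move=> c0 [sphi cphi phiO].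
have sE : [set x | c * phi x != 0] = [set x | phi x != 0].
  by apply/seteqP; split=> x /=; rewrite mulf_eq0 (gt_eqF c0).
split; rewrite ?sE// => s fs; rewrite /fs foldr_pderivZ//.
have [cs ds] := sphi s; split=> [x|i x].
  exact: (continuousM (@cst_continuous _ _ c x) (cs x)).
exact: (derivableZ (k := c) (ds i x)).
Qed.

End test_function_scaling.

Lemma test_fun_measurable (R : realType) (N : nat) (Omega D : set 'rV[R]_N) phi :
  test_fun Omega phi -> measurable_fun D phi /\
    forall i, measurable_fun D (pderiv i phi).
Proof.
move=> [sphi _ _]; split=> [|i].
  apply: (measurable_funS measurableT (@subsetT _ _)).
  by apply: continuous_measurable_rV; have [] := sphi [::].
apply: (measurable_funS measurableT (@subsetT _ _)).
by apply: continuous_measurable_rV; have [] := sphi [:: i].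
Qed.

(** * Positive multiples in the Sobolev space and in the form domain *)

Section energy_space_scaling.
Variables (R : realType) (N : nat) (Omega : set 'rV[R]_N).
Hypothesis oO : open Omega.
Variables (c : R) (c0 : 0 < c).
Local Notation mu := (leb R N).

Let mO : measurable Omega := open_measurable_rV oO.

Section ae_multiple.
Variables u w : 'rV[R]_N -> R.
Hypothesis mu_ : measurable_fun Omega u.
Hypothesis uE : {ae mu, forall x, Omega x -> u x = c * w x}.

Lemma Lp_ae_scale (p : nat) : Lp Omega p w -> Lp Omega p u.
Proof.
move=> [mw iw]; split => //.
have mn (v : 'rV[R]_N -> R) : measurable_fun Omega v -> measurable_fun Omega (fun x => `|v x| ^+ p).
  by move=> mv; apply: measurable_funX; exact: measurableT_comp.
apply: (ae_integrableZl (c := c ^+ p) mO (mn _ mw) (mn _ mu_) _ iw).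
by apply: filterS uE => x /= ux /ux ->; rewrite normrM (gtr0_norm c0) exprMn.
Qed.

Lemma weak_gradient_ae_scale (gw : 'I_N -> 'rV[R]_N -> R) :
  measurable_fun Omega w -> (forall i, measurable_fun Omega (gw i)) ->
  weak_gradient Omega w gw -> weak_gradient Omega u (fun i x => c * gw i x).
Proof.
move=> mw mgw wg i phi tphi.
have [mphi mdphi] := test_fun_measurable Omega tphi.
rewrite (ae_RintegralZl mO c0 (f := fun x => w x * pderiv i phi x)).
- rewrite wg// (ae_RintegralZl mO c0 (f := fun x => gw i x * phi x)
    (g := fun x => c * gw i x * phi x)) ?mulrN//.
  + exact: measurable_funM.
  + apply: measurable_funM => //.
    by apply: measurable_funM => //; exact: measurable_cst.
  + by apply: nearW => x _; rewrite mulrA.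
- exact: measurable_funM.
- exact: measurable_funM.
- by apply: filterS uE => x /= ux /ux ->; rewrite mulrA.
Qed.

Lemma dist_pow_ae_scale (p : nat) (phi : nat -> 'rV[R]_N -> R) :
  measurable_fun Omega w -> (forall k, measurable_fun Omega (phi k)) ->
  dist_pow Omega p (phi k) w @[k --> \oo] --> 0%E ->
  dist_pow Omega p (fun x => c * phi k x) u @[k --> \oo] --> 0%E.
Proof.
move=> mw mphi phiw.
rewrite (_ : (fun k => dist_pow Omega p (fun x => c * phi k x) u) =
    (fun k => (c ^+ p)%:E * dist_pow Omega p (phi k) w)%E).
  by rewrite -(mule0 (c ^+ p)%:E); apply: cvgeZl.
apply/funext => k; apply: ae_integralZl => //.
- exact: exprn_gt0.
- apply: measurable_funX; apply: measurableT_comp => //.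
  exact: measurable_funB.
- apply: measurable_funX; apply: measurableT_comp => //.
  apply: measurable_funB => //.
  by apply: measurable_funM => //; exact: measurable_cst.
- apply: filterS uE => x /= ux /ux ->.
  by rewrite -mulrBr normrM (gtr0_norm c0) exprMn.
Qed.

End ae_multiple.

(** If test functions [phi k] approximate [w], then [c * phi k] approximate [u]. Measurability of
    [u] is assumed separately: an a.e. equality with a Borel function does not make [u] Borel. *)
Lemma energy_space_ae_scale (a u w : 'rV[R]_N -> R) (gw : 'I_N -> 'rV[R]_N -> R) :
  measurable_fun Omega a -> measurable_fun Omega u ->
  {ae mu, forall x, Omega x -> u x = c * w x} ->
  energy_space Omega a w gw -> energy_space Omega a u (fun i x => c * gw i x).
Proof.
move=> ma mu_ uE [[[wL2 gwL2 wg] [phi [tphi phiw dphi]]] aw].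
have mw : measurable_fun Omega w by have [] := wL2.
have mgw i : measurable_fun Omega (gw i) by have [] := gwL2 i.
have mcgw i : measurable_fun Omega (fun x => c * gw i x).
  by apply: measurable_funM => //; exact: measurable_cst.
have cgwE i : {ae mu, forall x, Omega x -> c * gw i x = c * gw i x}.
  exact: nearW.
split; last first.
  apply: (ae_integrableZl (c := c ^+ 2) mO _ _ _ aw).
  - by apply: measurable_funM => //; exact: measurable_funX.
  - by apply: measurable_funM => //; exact: measurable_funX.
  - by apply: filterS uE => x /= ux /ux ->; ring.
split.
  split; [exact: Lp_ae_scale uE _ wL2| |exact: (weak_gradient_ae_scale mu_ uE)].
  by move=> i; exact: Lp_ae_scale (cgwE i) _ (gwL2 i).
exists (fun k x => c * phi k x); split.
- by move=> k; exact: test_funZ.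
- apply: (dist_pow_ae_scale mu_ uE mw _ phiw) => k.
  by have [] := test_fun_measurable Omega (tphi k).
- move=> i; rewrite (_ : (fun k => _) =
    (fun k => dist_pow Omega 2 (fun x => c * pderiv i (phi k) x)
                (fun x => c * gw i x))).
    apply: (dist_pow_ae_scale (mcgw i) (cgwE i) (mgw i) _ (dphi i)) => k.
    by have [] := test_fun_measurable Omega (tphi k).
  apply/funext => k; have [sphi _ _] := tphi k.
  by rewrite [pderiv _ _](foldr_pderivZ c [:: i] sphi).
Qed.

Lemma energy_form_ae_scale (a u w phi : 'rV[R]_N -> R)
    (gw gphi : 'I_N -> 'rV[R]_N -> R) :
  measurable_fun Omega a -> measurable_fun Omega u ->
  {ae mu, forall x, Omega x -> u x = c * w x} ->
  energy_space Omega a w gw -> energy_space Omega a phi gphi ->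
  energy_form Omega a u (fun i x => c * gw i x) phi gphi =
  c * energy_form Omega a w gw phi gphi.
Proof.
move=> ma mu_ uE [[[[mw _] gwL2 _] _] _] [[[[mphi _] gphiL2 _] _] _].
have mgw i : measurable_fun Omega (gw i) by have [] := gwL2 i.
have mgphi i : measurable_fun Omega (gphi i) by have [] := gphiL2 i.
rewrite /energy_form mulrDr; congr (_ + _).
  apply: ae_RintegralZl => //.
  - by apply: measurable_sum => i; exact: measurable_funM.
  - apply: measurable_sum => i; apply: measurable_funM => //.
    by apply: measurable_funM => //; exact: measurable_cst.
  - apply: nearW => x _; rewrite mulr_sumr; apply: eq_bigr => i _.
    by rewrite mulrA.
apply: ae_RintegralZl => //.
- by apply: measurable_funM => //; exact: measurable_funM.
- by apply: measurable_funM => //; exact: measurable_funM.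
- by apply: filterS uE => x /= ux /ux ->; ring.
Qed.

End energy_space_scaling.

Lemma energy_formC (R : realType) (N : nat) (Omega : set 'rV[R]_N)
    (a u w : 'rV[R]_N -> R) (gu gw : 'I_N -> 'rV[R]_N -> R) :
  energy_form Omega a u gu w gw = energy_form Omega a w gw u gu.
Proof.
congr (_ + _); apply: eq_Rintegral => x _; last by rewrite mulrAC.
by apply: eq_bigr => i _; rewrite mulrC.
Qed.

Lemma invariant_fun_ae_scale (R : realType) (N : nat) (Omega : set 'rV[R]_N)
    (G : set 'M[R]_N) (c : R) (u w : 'rV[R]_N -> R) :
  closed_orthogonal_subgroup G -> invariant_set G Omega ->
  {ae leb R N, forall x, Omega x -> u x = c * w x} ->
  invariant_fun G Omega w -> invariant_fun G Omega u.
Proof.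
move=> [GO _ _ _ _] GOmega uE wG A GA.
have uA : A^T \in unitmx.
  by rewrite unitmx_tr; have [] := mulmx1_unit (GO A GA).
(* The exceptional set of [uE] is pulled back along [A] and stays null, so the identity may be used
   at the moved point [lin_act A x]. *)
have uAE : {ae leb R N, forall x, Omega (lin_act A x) ->
    u (lin_act A x) = c * w (lin_act A x)}.
  have [Z [mZ Z0 ZP]] := uE.
  exists ((fun x => x *m A^T) @^-1` Z); split.
  - by rewrite -[X in measurable X]setTI; exact: measurable_mulmx.
  - exact: leb_null_mulmx.
  - by move=> x /= Nx; apply: ZP.
move: (wG A GA); apply: filterS3 uE uAE => x ux uAx wx Ox.
by rewrite uAx ?ux ?wx//; exact: GOmega.
Qed.

(** * Locked solutions *)

(** An open nonempty set has positive measure and cannot lie in the exceptional set. This turns a.e.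
    statements about constants into plain ones. *)
Lemma open_ae_ex (R : realType) (N : nat) (Omega : set 'rV[R]_N)
    (P : 'rV[R]_N -> Prop) :
  open Omega -> Omega !=set0 -> {ae leb R N, forall x, Omega x -> P x} ->
  exists2 x, Omega x & P x.
Proof.
move=> oO O0 [Z [mZ Z0 ZP]]; apply: contrapT => nP.
have : (0 < leb R N Omega)%E by exact: leb_open_gt0.
rewrite ltNge => /negP; apply; rewrite -Z0; apply: le_measure.
- by rewrite inE; exact: open_measurable_rV.
- by rewrite inE.
- by move=> x Ox; apply: ZP => /= Px; apply: nP; exists x => //; exact: Px.
Qed.

Section locked_solutions.
Variables (R : realType) (N : nat) (Omega : set 'rV[R]_N).
Variables (a : 'rV[R]_N -> R) (G : set 'M[R]_N).
Hypothesis oO : open Omega.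
Hypothesis ma : measurable_fun Omega a.
Local Notation mu := (leb R N).

Let mO : measurable Omega := open_measurable_rV oO.

Lemma in_E_measurable w : in_E Omega a G w -> measurable_fun Omega w.
Proof. by move=> [gw [[[[[]]]]]]. Qed.

Section ae_multiple.
Variables (c : R) (u w f h : 'rV[R]_N -> R).
Hypotheses (c0 : 0 < c) (mu_ : measurable_fun Omega u).
Hypothesis uE : {ae mu, forall x, Omega x -> u x = c * w x}.

Lemma in_E_ae_scale : closed_orthogonal_subgroup G -> invariant_set G Omega ->
  in_E Omega a G w -> in_E Omega a G u.
Proof.
move=> hG GOmega [gw [Ew wG]]; exists (fun i x => c * gw i x); split.
  exact: (energy_space_ae_scale oO c0 ma mu_ uE Ew).
exact: (invariant_fun_ae_scale hG GOmega uE wG).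
Qed.

Lemma pos_ae_scale : pos_ae Omega w -> pos_ae Omega u.
Proof.
by move: uE; apply: filterS2 => x /= ux wx Ox; rewrite ux// mulr_gt0// wx.
Qed.

Lemma weak_solution_ae_scale :
  measurable_fun Omega f -> measurable_fun Omega h ->
  {ae mu, forall x, Omega x -> h x = c * f x} ->
  weak_solution Omega a w f -> weak_solution Omega a u h.
Proof.
move=> mf mh hE [gw Ew wf].
exists (fun i x => c * gw i x) => [|phi gphi Ephi].
  exact: (energy_space_ae_scale oO c0 ma mu_ uE Ew).
have mphi : measurable_fun Omega phi by case: Ephi => [[[[]]]].
rewrite (energy_form_ae_scale oO c0 ma mu_ uE Ew Ephi) wf//.
apply/esym/ae_RintegralZl => //; [exact: measurable_funM..|].
by apply: filterS hE => x /= hx /hx ->; rewrite mulrA.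
Qed.

End ae_multiple.

Variables (n : nat) (m : 'I_n -> R) (beta : R) (u : 'I_n -> 'rV[R]_N -> R).
Hypothesis hu : forall j, measurable_fun Omega (u j).

Let rhs j x := m j * u j x ^+ 3 +
  beta * \sum_(k < n | k != j) u k x ^+ 2 * u j x.

Lemma measurable_rhs j : measurable_fun Omega (rhs j).
Proof.
apply: measurable_funD.
  by apply: measurable_funM; [exact: measurable_cst|exact: measurable_funX].
apply: measurable_funM; first exact: measurable_cst.
(* The condition [k != j] is moved into the list, the form of sum that [measurable_sum] handles. *)
rewrite (_ : (fun x => _) =
    fun x => \sum_(k <- [seq k <- index_enum _ | k != j]) u k x ^+ 2 * u j x).
  apply: measurable_sum => k.
  by apply: measurable_funM => //; exact: measurable_funX.
by apply/funext => x; rewrite big_filter.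
Qed.

(** Completing the coupling sum by its missing term [k = j] costs [beta * c j ^+ 2], whence the
    factor [m j - beta]. *)
Lemma rhs_ae_scale (w : 'rV[R]_N -> R) (c : 'I_n -> R) j :
  (forall k, {ae mu, forall x, Omega x -> u k x = c k * w x}) ->
  {ae mu, forall x, Omega x -> rhs j x =
    ((m j - beta) * c j ^+ 2 + beta * \sum_k c k ^+ 2) * (c j * w x ^+ 3)}.
Proof.
move=> uE; have {}uE : {ae mu, forall x, forall k, Omega x -> u k x = c k * w x}.
  exact: filter_forall.
apply: filterS uE => x uE Ox; rewrite /rhs uE//.
under eq_bigr => k _ do rewrite uE//.
rewrite [in RHS](bigD1 j)//=.
have -> : \sum_(k | k != j) (c k * w x) ^+ 2 * (c j * w x) =
    (\sum_(k | k != j) c k ^+ 2) * (c j * w x ^+ 3).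
  by rewrite mulr_suml; apply: eq_bigr => k _; ring.
by ring.
Qed.

(** The condition on the [c j] reduces the j-th right-hand side to [c j * w ^+ 3], so each equation
    is [c j] times the scalar one. *)
Lemma system_of_scalar (w : 'rV[R]_N -> R) (c : 'I_n -> R) :
  Omega !=set0 -> closed_orthogonal_subgroup G -> invariant_set G Omega ->
  scalar_solution Omega a G w -> (forall j, 0 < c j) ->
  (forall j, (m j - beta) * c j ^+ 2 + beta * \sum_k c k ^+ 2 = 1) ->
  (forall j, {ae mu, forall x, Omega x -> u j x = c j * w x}) ->
  system_solution Omega a G m beta u /\ locked_tuple Omega u.
Proof.
move=> O0 hG GOmega [Ew w0 ww] c0 c1 uE; have mw := in_E_measurable Ew.
split=> [j|i j].
  split.
  - exact: (in_E_ae_scale (c0 j) (hu j) (uE j)).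
  - exact: (pos_ae_scale (c0 j) (uE j)).
  - apply: (weak_solution_ae_scale (c0 j) (hu j) (uE j) _ (measurable_rhs j) _ ww).
      exact: measurable_funX.
    by apply: filterS (rhs_ae_scale j uE) => x /= + Ox => ->//; rewrite c1 mul1r.
exists (c i / c j); move: w0 (uE i) (uE j); apply: filterS3 => x /= wx uix ujx Ox.
rewrite uix// ujx// -mulf_div divff ?mulr1//.
by rewrite gt_eqF// wx.
Qed.

Lemma scalar_of_system (o : 'I_n) :
  Omega !=set0 -> closed_orthogonal_subgroup G -> invariant_set G Omega ->
  E_norm_definite Omega a G -> (forall v, in_E Omega a G v -> Lp Omega 4 v) ->
  system_solution Omega a G m beta u -> locked_tuple Omega u ->
  exists w (c : 'I_n -> R), [/\ scalar_solution Omega a G w,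
    (forall j, 0 < c j),
    (forall j, (m j - beta) * c j ^+ 2 + beta * \sum_k c k ^+ 2 = 1) &
    (forall j, {ae mu, forall x, Omega x -> u j x = c j * w x})].
Proof.
move=> O0 hG GOmega normE L4 su lu.
have pu j : pos_ae Omega (u j) by case: (su j).
have [c cE] := choice (fun j => lu j o).
have c0 j : 0 < c j.
  (* The sign of the constant [c j] is read off at a single point of [Omega]. *)
  suff : {ae mu, forall x, Omega x -> 0 < c j} by move/(open_ae_ex oO O0) => [].
  move: (pu j) (pu o) (cE j); apply: filterS3 => x /= ujx uox cx Ox.
  by rewrite -cx// divr_gt0 ?ujx ?uox.
have co1 : c o = 1.
  suff : {ae mu, forall x, Omega x -> c o = 1} by move/(open_ae_ex oO O0) => [].
  move: (pu o) (cE o); apply: filterS2 => x /= uox cx Ox.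
  by rewrite -cx// divff// gt_eqF// uox.
have uE j : {ae mu, forall x, Omega x -> u j x = c j * u o x}.
  move: (pu o) (cE j); apply: filterS2 => x /= uox cx Ox.
  by rewrite -cx// divfK// gt_eqF// uox.
pose K j := (m j - beta) * c j ^+ 2 + beta * \sum_k c k ^+ 2.
pose I := \int[mu]_(x in Omega) (u o x ^+ 4).
(* The constants [K i * c i * c j] have no known sign yet, so pulling them out of the integral needs
   integrability, supplied by the embedding into [L^4]. *)
have int4 : mu.-integrable Omega (EFin \o (fun x => u o x ^+ 4)).
  have [_] : Lp Omega 4 (u o) by apply: L4; case: (su o).
  by apply: eq_integrable => // x _ /=; rewrite -normrX ger0_norm// exprn_even_ge0.
have IE i j : \int[mu]_(x in Omega) (rhs i x * u j x) = K i * c i * c j * I.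
  rewrite -RintegralZl//; apply: eq_ae_Rintegral => //.
  - by apply: measurable_funM => //; exact: measurable_rhs.
  - by apply: measurable_funM; [exact: measurable_cst|exact: measurable_funX].
  - move: (uE j) (rhs_ae_scale i uE); apply: filterS2 => x /= ujx rx Ox.
    by rewrite rx// ujx// /K; ring.
have [_ _ [gu Eu uf]] := su o.
(* Testing the equation of [u o] with [u o] itself gives its squared energy norm, which is positive
   because [u o] is not zero a.e. *)
have KI0 : 0 < K o * I.
  have := IE o o; rewrite co1 !mulr1 => <-.
  rewrite -(uf _ gu Eu); apply: normE.
    by split=> //; case: (su o) => -[? []].
  move=> u0; have /(open_ae_ex oO O0)[x _ []] :
      {ae mu, forall x, Omega x -> 0 < u o x /\ u o x = 0}.
    by move: (pu o) u0; apply: filterS2 => x /= p q Ox; split; [exact: p|exact: q].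
  by move=> + ux; rewrite ux ltxx.
have I0 : 0 <= I by apply: Rintegral_ge0 => x _; rewrite exprn_even_ge0.
have Ko0 : 0 < K o.
  by rewrite ltNge; apply/negP => Kle; move: KI0; rewrite ltNge mulr_le0_ge0.
have {}I0 : 0 < I by move: KI0; rewrite pmulr_rgt0.
(* Cross testing gives [K j * c j * I = K o * c j * I], and [c j] and [I] are nonzero. *)
have KE j : K j = K o.
  have [_ _ [gj Ej ujf]] := su j.
  have := uf _ _ Ej; rewrite energy_formC (ujf _ _ Eu) [LHS]IE IE co1.
  by rewrite !mulr1 => /(mulIf (lt0r_neq0 I0)) /(mulIf (lt0r_neq0 (c0 j))).
pose s := Num.sqrt (K o).
have s0 : 0 < s by rewrite sqrtr_gt0.
have sK : s ^+ 2 = K o by rewrite sqr_sqrtr// ltW.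
have mw : measurable_fun Omega (fun x => s * u o x).
  by apply: measurable_funM => //; exact: measurable_cst.
have wE : {ae mu, forall x, Omega x -> s * u o x = s * u o x} by exact: nearW.
exists (fun x => s * u o x), (fun j => c j / s); split.
- have [Eo po wo] := su o; split.
  + exact: (in_E_ae_scale s0 mw wE).
  + exact: (pos_ae_scale s0 wE).
  + apply: (weak_solution_ae_scale s0 mw wE (measurable_rhs o) _ _ wo).
      exact: measurable_funX.
    apply: filterS (rhs_ae_scale o uE) => x /= + Ox => ->//.
    by rewrite -/(K o) co1 -sK; ring.
- by move=> j; rewrite divr_gt0.
(* Dividing every coefficient by [s] divides [K j] by [s ^+ 2 = K o = K j]. *)
- move=> j; under eq_bigr do rewrite expr_div_n.
  rewrite -mulr_suml expr_div_n (mulrA _ (c j ^+ 2)) (mulrA beta) -mulrDl sK -[X in X / _]/(K j) (KE j).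
  by rewrite divff// gt_eqF.
- move=> j; apply: filterS (uE j) => x /= + Ox => ->//.
  by rewrite mulrA divfK// gt_eqF.
Qed.

End locked_solutions.

(** * The algebraic system for the coefficients *)

Section coupling_coefficients.
Variables (R : realType) (n : nat) (hn : (2 <= n)%N) (m : 'I_n -> R).
Hypothesis hm0 : 0 < mu_first hn m.
Hypothesis hm : forall i j : 'I_n, (i <= j)%N -> m i <= m j.
Local Notation g := (gfun m).

Lemma mu_first_le j : mu_first hn m <= m j. Proof. exact: hm. Qed.

Lemma le_mu_last j : m j <= mu_last hn m.
Proof. by apply: hm => /=; rewrite -ltnS (ltn_predK hn). Qed.

Lemma mu_gt0 j : 0 < m j.
Proof. exact: lt_le_trans hm0 (mu_first_le j). Qed.

(** Nonemptiness of the index set, in the form needed for strict inequalities between sums. *)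
Lemma has_index_enum_ord : has predT (index_enum 'I_n).
Proof.
by apply/hasP; exists (Ordinal (ltnW hn)) => //; rewrite mem_index_enum.
Qed.

(** Since [b / (m j - b) = m j / (m j - b) - 1], the variable [b] remains only in denominators,
    which exposes the monotonicity and sign of each term. *)
Lemma gfunE b : (forall j, m j - b != 0) ->
  g b = 1 + \sum_j (m j / (m j - b) - 1).
Proof.
move=> mb; congr (_ + _); rewrite mulr_sumr; apply: eq_bigr => j _.
by have := mb j => ?; field.
Qed.

Lemma gfun_ltr x y : x < y -> y < mu_first hn m -> g x < g y.
Proof.
move=> xy ym.
have lt_m z : z <= y -> forall j, 0 < m j - z.
  by move=> zy j; rewrite subr_gt0 (le_lt_trans zy)// (lt_le_trans ym)// mu_first_le.
have mE z : z <= y -> g z = 1 + \sum_j (m j / (m j - z) - 1).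
  by move=> zy; apply: gfunE => j; rewrite gt_eqF// lt_m.
rewrite (mE x) ?ltW// mE// ltrD2l; apply: ltr_sum => [|j _].
  exact: has_index_enum_ord.
rewrite ltrD2r ltr_pM2l ?mu_gt0// ltf_pV2 ?posrE ?lt_m// ?(ltW xy)//.
by rewrite ltrD2l ltrN2.
Qed.

(** [get] is meaningful only once a zero exists. The intermediate value theorem yields one in
    [[- M, 0]], with [M] the largest coefficient. *)
Lemma betabarP : betabar hn m < mu_first hn m /\ g (betabar hn m) = 0.
Proof.
suff [b b0 gb] : exists2 b, b <= 0 & g b = 0.
  apply: (getPex (P := [set b | b < mu_first hn m /\ g b = 0])).
  by exists b; split=> //=; exact: (le_lt_trans b0).
pose M := mu_last hn m.
have M0 : 0 < M by apply: lt_le_trans (mu_gt0 _) (le_mu_last (Ordinal (ltnW hn))).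
have g0 : g 0 = 1 by rewrite /gfun mul0r addr0.
have gM : g (- M) <= 0.
  rewrite gfunE => [|j]; last by rewrite opprK gt_eqF// addr_gt0// mu_gt0.
  (* As [m j <= M], the ratio [m j / (m j + M)] is at most 1/2. Hence
     [g (- M) <= 1 - n / 2 <= 0]. *)
  have le_half j : m j / (m j - - M) - 1 <= - 2^-1.
    rewrite opprK lerBlDr (_ : - 2^-1 + 1 = 2^-1); last by field.
    rewrite ler_pdivrMr ?addr_gt0 ?mu_gt0//.
    by have := le_mu_last j; rewrite -/M; lra.
  apply: (@le_trans _ _ (1 + \sum_(j < n) (- 2^-1))).
    by rewrite lerD2l; apply: ler_sum.
  have n2 : 2 <= n%:R :> R by rewrite ler_nat.
  by rewrite sumr_const card_ord -[_ *+ n]mulr_natl; lra.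
have M0' : - M <= 0 by rewrite oppr_le0 ltW.
have cg : {within `[- M, 0], continuous g}.
  apply: continuous_in_subspaceT => x; rewrite inE /= in_itv/= => /andP[_ x0].
  have mx j : m j - x != 0 by rewrite gt_eqF// subr_gt0 (le_lt_trans x0)// mu_gt0.
  apply: cvgD; first exact: cvg_cst.
  apply: cvgM; first exact: cvg_id.
  apply: cvg_big => [|j _]; first exact: add_continuous.
  apply: cvgV => //.
  by apply: cvgB; [exact: cvg_cst|exact: cvg_id].
have [|b] := IVT M0' cg (v := 0).
  by rewrite g0 ge_min gM le_max ler01 orbT.
by rewrite in_itv/= => /andP[_ b0] gb; exists b.
Qed.

Lemma gfun_gt0 b : b < mu_first hn m -> (0 < g b) = (betabar hn m < b).
Proof.
move=> bm; have [bbm gbb] := betabarP; rewrite -gbb.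
have [bb|bb|<-] := ltgtP (betabar hn m) b; first exact: gfun_ltr.
  by apply/negbTE; rewrite -leNgt ltW// gfun_ltr.
by rewrite ltxx.
Qed.

(** To the right of all the [m j] each ratio [m j / (m j - b)] is negative, so
    [g b < 1 - n <= 0]. *)
Lemma gfun_lt0 b : mu_last hn m < b -> g b < 0.
Proof.
move=> bm; have mb j : 0 < b - m j by rewrite subr_gt0 (le_lt_trans (le_mu_last j)).
have lt_m1 j : m j / (m j - b) - 1 < - 1.
  rewrite ltrBlDr addNr -opprB invrN mulrN oppr_lt0.
  by rewrite divr_gt0// mu_gt0.
rewrite gfunE => [|j]; last by rewrite -opprB oppr_eq0 gt_eqF.
apply: (@lt_le_trans _ _ (1 + \sum_(j < n) (- 1))).
  rewrite ltrD2l; apply: ltr_sum => //.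
  exact: has_index_enum_ord.
by rewrite sumr_const card_ord mulNrn subr_le0 (ler_nat _ 1) ltnW.
Qed.

(** In both ranges [m j - b] and [g b] have the same sign, so the square root is that of a positive
    number. The equations then read [(1 + b * S') / g b = 1], where [S'] is the sum of the
    [(m k - b)^-1]. *)
Lemma alpha_coef_spec b :
  (betabar hn m < b /\ b < mu_first hn m) \/ mu_last hn m < b ->
  (forall j, 0 < alpha_coef m j b) /\
  forall j, (m j - b) * alpha_coef m j b ^+ 2 +
    b * \sum_k alpha_coef m k b ^+ 2 = 1.
Proof.
move=> hb; have [g0 mg0] : g b != 0 /\ forall j, 0 < (m j - b) * g b.
  case: hb => [[bb bm]|bm].
    have gb : 0 < g b by rewrite gfun_gt0.
    split=> [|j]; first by rewrite gt_eqF.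
    by rewrite mulr_gt0// subr_gt0 (lt_le_trans bm)// mu_first_le.
  have gb := gfun_lt0 bm; split=> [|j]; first by rewrite lt_eqF.
  by rewrite nmulr_lgt0// subr_lt0 (le_lt_trans (le_mu_last j)).
have mb j : m j - b != 0.
  by apply: contraTneq (mg0 j) => ->; rewrite mul0r ltxx.
have a2 j : alpha_coef m j b ^+ 2 = (m j - b)^-1 / g b.
  by rewrite /alpha_coef exprVn sqr_sqrtr ?invfM// ltW.
split=> j; first by rewrite invr_gt0 sqrtr_gt0.
under eq_bigr do rewrite a2.
rewrite a2 mulrA divff// -mulr_suml mulrA -mulrDl.
by rewrite -/(gfun m b) divff.
Qed.

(* With D = 1 - b * S, S the sum of the c_k^2, the equations read
   (m_j - b) c_j^2 = D.  The sign of D separates the three ranges of b, and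
   summing c_j^2 = D / (m_j - b) gives D * g b = 1 when D != 0. *)
Lemma coef_classification b (c : 'I_n -> R) : (forall j, 0 < c j) ->
  (forall j, (m j - b) * c j ^+ 2 + b * \sum_k c k ^+ 2 = 1) ->
  (((betabar hn m < b /\ b < mu_first hn m) \/ mu_last hn m < b) /\
    forall j, c j = alpha_coef m j b) \/
  ((forall j, b = m j) /\ \sum_k c k ^+ 2 = b^-1).
Proof.
move=> c0; set S := \sum_k _ => cS; pose D := 1 - b * S.
have cD j : (m j - b) * c j ^+ 2 = D by rewrite /D -(cS j); ring.
have c20 j : 0 < c j ^+ 2 by rewrite exprn_gt0.
have [D0|D0] := eqVneq D 0.
  right; have bS : b * S = 1 by apply/esym/eqP; rewrite -subr_eq0; apply/eqP.
  split=> [j|].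
    have /eqP := cD j; rewrite D0 mulf_eq0 (gt_eqF (c20 j)) orbF subr_eq0.
    by move=> /eqP.
  have b0 : b != 0 by apply: contra_eq_neq bS => ->; rewrite mul0r eq_sym oner_eq0.
  by apply: (mulfI b0); rewrite bS divff.
left.
have mb j : m j - b != 0.
  by apply: contra_neq D0 => mb; rewrite -(cD j) mb mul0r.
have cE j : c j ^+ 2 = D / (m j - b) by rewrite -(cD j) mulrC mulKf.
have Dg : D * g b = 1.
  have -> : g b = 1 + b * (S / D).
    rewrite /gfun /S; under [in RHS]eq_bigr do rewrite cE.
    by rewrite -mulr_sumr mulrAC divff// mul1r.
  by rewrite /D; rewrite /D in D0; field.
have gD : g b = D^-1 by apply: (mulfI D0); rewrite Dg divff.
split; last first.
  (* With [g b = D^-1], the number under the root is the inverse of [c j ^+ 2], and [c j] is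
     positive. *)
  move=> j; rewrite /alpha_coef gD -invf_div -cE sqrtrV ?ltW// invrK.
  by rewrite sqrtr_sqr gtr0_norm.
(* All [m j - b] have the sign of [D]. Comparison with the first index settles [D > 0], where also
   [g b = D^-1 > 0], and comparison with the last index settles [D < 0]. *)
have [Dp|Dn|D0'] := ltgtP 0 D; last by rewrite -D0' eqxx in D0.
  left.
  have bm : b < mu_first hn m.
    have sgn j : 0 < m j - b by rewrite -(pmulr_lgt0 _ (c20 j)) cD.
    by rewrite -subr_gt0; exact: sgn.
  by split=> //; rewrite -gfun_gt0// gD invr_gt0.
have sgn j : m j - b < 0 by rewrite -(pmulr_llt0 _ (c20 j)) cD.
by right; rewrite -subr_lt0; exact: sgn.
Qed.

End coupling_coefficients.

Theorem proposition2p1 (R : realType) (n : nat) (hn : (2 <= n)%N)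
  (N : nat) (hN : (1 <= N <= 3)%N)
  (Omega : set 'rV[R]_N) (hOmega : is_domain Omega)
  (G : set 'M[R]_N) (hG : closed_orthogonal_subgroup G)
  (hGOmega : invariant_set G Omega)
  (a : 'rV[R]_N -> R) (ha : Linfty_loc Omega a)
  (haG : invariant_fun G Omega a)
  (hop : positive_self_adjoint Omega (schrodinger_op Omega a))
  (hnorm : E_norm_definite Omega a G)
  (hcompact : E_compact_in_L4 Omega a G)
  (m : 'I_n -> R) (hm0 : 0 < mu_first hn m)
  (hm : forall i j : 'I_n, (i <= j)%N -> m i <= m j)
  (beta : R) (u : 'I_n -> 'rV[R]_N -> R)
  (hu : forall j, measurable_fun Omega (u j)) :
  (system_solution Omega a G m beta u /\ locked_tuple Omega u) <->
  ((((betabar hn m < beta /\ beta < mu_first hn m) \/ mu_last hn m < beta) /\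
    exists w, scalar_solution Omega a G w /\
      forall j, {ae leb R N, forall x, Omega x -> u j x = alpha_coef m j beta * w x})
   \/
   ((forall j, beta = m j) /\
    exists w (c : 'I_n -> R),
      [/\ scalar_solution Omega a G w,
          forall j, 0 < c j,
          \sum_(j < n) c j ^+ 2 = beta^-1 &
          forall j, {ae leb R N, forall x, Omega x -> u j x = c j * w x}])).
Proof.
have ma : measurable_fun Omega a by case: ha.
have [oO _ O0] := hOmega; have [L4 _] := hcompact.
split=> [[su lu]|].
  have [w [c [sw c0 c1 uE]]] :=
    scalar_of_system oO ma hu (Ordinal (ltnW hn)) O0 hG hGOmega hnorm L4 su lu.
  (* Whether the coupling equals all the [m j] decides between the two families. *)
  have [[hb cE]|[bm cS]] := coef_classification hm0 hm c0 c1.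
    by left; split=> //; exists w; split=> // j; rewrite -cE.
  by right; split=> //; exists w, c.
case=> [[hb [w [sw uE]]]|[bm [w [c [sw c0 cS uE]]]]].
  have [al0 al1] := alpha_coef_spec hm0 hm hb.
  exact: (system_of_scalar oO ma hu O0 hG hGOmega sw al0 al1 uE).
apply: (system_of_scalar oO ma hu O0 hG hGOmega sw c0 _ uE) => j.
(* Here [m j - beta = 0], so the condition reduces to [beta * beta^-1 = 1], valid because [beta]
   equals a positive [m j]. *)
rewrite cS -bm subrr mul0r add0r divff// (bm (Ordinal (ltnW hn))).
by rewrite gt_eqF// (mu_gt0 hm0 hm).
Qed.
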